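(* Let $D$ be a positive even integer, let $Q_D$ be the $D$-cube with adjacency matrix $\mathbf A$, base vertex $\mathbf x$, Terwilliger algebra $T=T(\mathbf x)$ and dual adjacency matrix $\mathbf B$ (with respect to $\mathbf x$ and the $Q$-polynomial ordering $\{(-1)^i(D-2i)\}_{i=0}^D$), and let $\mathbf C=\tfrac12(\mathbf A\mathbf B+\mathbf B\mathbf A)$. Let $W$ be an irreducible $T$-module. Then the actions of $\mathbf A,\mathbf B,\mathbf C$ on $W$ form a totally bipartite Leonard triple of Bannai/Ito type.
   Context: $Q_D$ has vertex set $\mathcal X=\{0,1\}^D$, two vertices adjacent iff they differ in exactly one coordinate; $\partial$ is Hamming distance; $V=\mathbb C^{\mathcal X}$ is its standard module (matrices act by left multiplication). $\mathbf A$ is the adjacency matrix. $\mathbf B$ is the diagonal matrix with $(\mathbf y,\mathbf y)$-entry $|\mathcal X|(\mathbf F_1)_{\mathbf x\mathbf y}$, where $\mathbf F_1$ is the primitive idempotent (orthogonal projection onto the eigenspace) of $\mathbf A$ for the eigenvalue $-(D-2)$; equivalently its $(\mathbf y,\mathbf y)$-entry is $(-1)^i(D-2i)$, $i=\partial(\mathbf x,\mathbf y)$. $\mathbf E_i^*$ ($0\le i\le D$) is diagonal with $(\mathbf y,\mathbf y)$-entry $1$ if $\partial(\mathbf x,\mathbf y)=i$ and $0$ otherwise; $T$ is the algebra generated by $\mathbf A,\mathbf E_0^*,\dots,\mathbf E_D^*$; an irreducible $T$-module is a nonzero $T$-invariant subspace of $V$ with no $T$-invariant subspaces other than $0$ and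 itself. (The matrix $\mathbf C$ is the action of $z$ under the $\mathcal A$-module structure on $V$ with $x\mapsto\mathbf A$, $y\mapsto\mathbf B$, where $\mathcal A$ has relations $xy+yx=2z$, $yz+zy=2x$, $zx+xz=2y$.) Leonard triples: a square matrix is tridiagonal if all nonzero entries lie on the diagonal, subdiagonal or superdiagonal, and irreducible tridiagonal if moreover all sub- and superdiagonal entries are nonzero. For a vector space $U$ of finite positive dimension $d+1$, a Leonard triple on $U$ is an ordered triple $A,A^*,A^\varepsilon$ of linear maps $U\to U$ such that for each of the three maps there is a basis of $U$ in which that map is diagonal and the other two are irreducible tridiagonal; $d$ is its diameter. It is totally bipartite if each of the six tridiagonal matrices so obtained has all diagonal entries zero. It is of Bannai/Ito type if, for a basis $v_0,\dots,v_d$ in which $A$ is diagonal and $A^*,A^\varepsilon$ are irreducible tridiagonal, with $Av_i=\theta_iv_i$, one has $(\theta_{i-2}-\theta_{i+1})/(\theta_{i-1}-\theta_i)=-1$ for $2\le i\le d-1$. *)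

(* Defs.v *)
From mathcomp Require Import all_boot all_order all_algebra.
From mathcomp Require Import reals complex.

Set Implicit Arguments.
Unset Strict Implicit.
Unset Printing Implicit Defensive.

Import GRing.Theory.
Local Open Scope ring_scope.

Section LeonardTriples.
Variables (F : fieldType) (U : vectType F).

Definition tridiagonal n (M : 'M[F]_n) : Prop :=
  forall i j : 'I_n, M i j != 0 -> (i <= j.+1)%N && (j <= i.+1)%N.

Definition irred_tridiagonal n (M : 'M[F]_n) : Prop :=
  tridiagonal M /\
  forall i j : 'I_n, (i == j.+1 :> nat) || (j == i.+1 :> nat) -> M i j != 0.

Definition zero_diagonal n (M : 'M[F]_n) : Prop := forall i, M i i = 0.

Local Notation dimU := (\dim {: U}).

Definition mx_in_basis (b : dimU.-tuple U) (f : 'End(U)) : 'M[F]_dimU :=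
  \matrix_(i, j) coord b i (f b`_j).

Definition leonard_basis (A B C : 'End(U)) (b : dimU.-tuple U) : Prop :=
  [/\ basis_of {: U} b, is_diag_mx (mx_in_basis b A),
      irred_tridiagonal (mx_in_basis b B)
    & irred_tridiagonal (mx_in_basis b C)].

Definition leonard_triple (A B C : 'End(U)) : Prop :=
  [/\ (0 < dimU)%N, exists b, leonard_basis A B C b,
      exists b, leonard_basis B A C b & exists b, leonard_basis C A B b].

Definition zero_diagonals (A B C : 'End(U)) : Prop :=
  forall b, leonard_basis A B C b ->
    zero_diagonal (mx_in_basis b B) /\ zero_diagonal (mx_in_basis b C).

(* The bases in the definition of a Leonard triple are unique up to scaling
   and reversal, so nothing depends on their choice; here and in
   bannai_ito_type the condition is required for all of them. *)
Definition totally_bipartite (A B C : 'End(U)) : Prop :=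
  [/\ zero_diagonals A B C, zero_diagonals B A C & zero_diagonals C A B].

(* The diameter is d = dimU - 1, so i.+1 < dimU means i <= d - 1. *)
Definition bannai_ito_type (A B C : 'End(U)) : Prop :=
  forall (b : dimU.-tuple U) (theta : nat -> F), leonard_basis A B C b ->
    (forall i : nat, (i < dimU)%N -> A b`_i = theta i *: b`_i) ->
    forall i : nat, (2 <= i)%N -> (i.+1 < dimU)%N ->
      (theta (i - 2)%N - theta i.+1) / (theta i.-1 - theta i) = -1.

End LeonardTriples.

Section Hypercube.
Variables (C : numClosedFieldType) (D : nat).

Definition cube := {ffun 'I_D -> bool}.

Definition hamming (y z : cube) : nat := #|[set i | y i != z i]|.

(* Matrices with rows and columns indexed by cube, and the standard module,
   through the enumeration of cube. *)
Definition cube_mx := 'M[C]_#|{: cube}|.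
Definition cube_cV := 'cV[C]_#|{: cube}|.

Definition mx_of_cube (f : cube -> cube -> C) : cube_mx :=
  \matrix_(i, j) f (enum_val i) (enum_val j).

Definition diag_of_cube (f : cube -> C) : cube_mx :=
  mx_of_cube (fun y z => if y == z then f y else 0).

Definition adjA : cube_mx :=
  mx_of_cube (fun y z => if hamming y z == 1%N then 1 else 0).

(* Orthogonal projection of the column space onto {v | M *m v = a *: v}.
   eigenspace and proj_ortho are about row vectors, whence the transposes. *)
Definition prim_idempotent n (M : 'M[C]_n) (a : C) : 'M[C]_n :=
  (proj_ortho (eigenspace M^T a))^T.

Definition idemF1 : cube_mx := prim_idempotent adjA (- (D%:R - 2)).

Definition dual_adjB (x : cube) : cube_mx :=
  diag_of_cube (fun y =>
    #|{: cube}|%:R * idemF1 (enum_rank x) (enum_rank y)).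

Definition mxC (x : cube) : cube_mx :=
  2^-1 *: (adjA *m dual_adjB x + dual_adjB x *m adjA).

Definition dual_idem (x : cube) (i : 'I_D.+1) : cube_mx :=
  diag_of_cube (fun y => if hamming x y == i then 1 else 0).

Inductive terwilliger (x : cube) : cube_mx -> Prop :=
| terwilliger_A : terwilliger x adjA
| terwilliger_E i : terwilliger x (dual_idem x i)
| terwilliger_1 : terwilliger x 1%:M
| terwilliger_Z a M : terwilliger x M -> terwilliger x (a *: M)
| terwilliger_D M N :
    terwilliger x M -> terwilliger x N -> terwilliger x (M + N)
| terwilliger_M M N :
    terwilliger x M -> terwilliger x N -> terwilliger x (M *m N).

Definition T_invariant (x : cube) (W : {vspace cube_cV}) : Prop :=
  forall M, terwilliger x M -> forall v, v \in W -> M *m v \in W.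

Definition irred_T_module (x : cube) (W : {vspace cube_cV}) : Prop :=
  [/\ W != 0%VS, T_invariant x W
    & forall W' : {vspace cube_cV}, (W' <= W)%VS -> T_invariant x W' ->
        W' = 0%VS \/ W' = W].

(* When M maps W into W this is the restriction of M to W, as vsproj W is then
   the inverse of vsval on the image. *)
Definition action_on (W : {vspace cube_cV}) (M : cube_mx) :
    'End(subvs_of W) :=
  linfun (vsproj W \o mulmx M \o vsval).

End Hypercube.

Arguments adjA C D : clear implicits.
Arguments idemF1 C D : clear implicits.
Arguments dual_adjB C {D} x.
Arguments mxC C {D} x.
Arguments dual_idem C {D} x i.

(* Main.v *)
(* Let r be the endpoint of W.  The raising and lowering parts of A satisfy the
   sl2 relation, so a lowest vector v of W generates a basis u_k = R^k v,
   0 <= k <= d, with D = 2r + d.  On it B acts by (-1)^(r+k) (d - 2k), A by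
   u_k |-> u_(k+1) + k(d+1-k) u_(k-1) and C by the same formula with signs; call
   such a sequence a chain for (B, A, C).  The relations XY + YX = 2Z and the
   Casimir identity X^2 + Y^2 + Z^2 = d^2 + 2d follow.  They turn a chain for
   (X, Y, Z) into chains for (X, Z, Y), by rescaling, and for (Y, X, Z), by
   applying X + Z and X - Z alternately to the Y-eigenvector
   sum_k e^k u_k / k!, so all three operators have a Leonard basis.
   For an arbitrary Leonard basis with X diagonal, comparing entries of
   XY + YX = 2Z and XZ + ZX = 2Y gives (theta_i + theta_j)^2 = 4 whenever
   Y_ij <> 0.  As d is even, every theta_i is an even integer, so Y_ii = 0; and
   as the theta_i are distinct, theta_i + theta_(i+1) alternates between 2 and
   -2. *)

Require Import Defs.
From mathcomp Require Import all_boot all_order all_algebra.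
From mathcomp Require Import reals complex.
From mathcomp Require Import ring zify.

Set Implicit Arguments.
Unset Strict Implicit.
Unset Printing Implicit Defensive.

Import Order.TTheory GRing.Theory Num.Theory.
Local Open Scope ring_scope.

(** * Chains *)

Section Eigenbasis.
Variables (F : fieldType) (U : vectType F).
Implicit Types (X : 'End(U)) (w : nat -> U) (th : nat -> F).

(** Testing a vector identity against all linear forms turns it into a scalar identity, which [ring]
    can decide. *)
Lemma scalar_ext (u v : U) : (forall f : {scalar U}, f u = f v) -> u = v.
Proof.
move=> h.
rewrite (coord_basis (vbasisP {:U}) (memvf u)).
rewrite (coord_basis (vbasisP {:U}) (memvf v)).
by apply: eq_bigr => i _; rewrite (h (coord (vbasis {:U}) i)).
Qed.

(** Applying [X] minus [th n] to a linear relation removes its last term and multiplies the other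
    coefficients by nonzero factors, so induction applies. *)
Lemma eigenvectors_free X w th n :
    (forall i, (i < n)%N -> w i != 0 /\ X (w i) = th i *: w i) ->
    (forall i j, (i < j < n)%N -> th i != th j) ->
  forall a : nat -> F, \sum_(i < n) a i *: w i = 0 ->
  forall i, (i < n)%N -> a i = 0.
Proof.
elim: n => [|n IHn] // hw hth a.
rewrite big_ord_recr /= => h0.
have a0 i : (i < n)%N -> a i = 0.
  move=> lin; apply/eqP; have /eqP : a i * (th i - th n) = 0.
    apply: (IHn _ _ (fun i => a i * (th i - th n))) => //.
    - by move=> j ltj; apply: hw; apply: ltnW.
    - by move=> j k /andP[ltj ltk]; apply: hth; rewrite ltj ltnW.
    have : X (\sum_(i < n) a i *: w i + a n *: w n) - th n *: (\sum_(i < n) a i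
      *: w i + a n *: w n) = 0.
      by rewrite h0 linear0 scaler0 subr0.
    rewrite linearD linearZ /= (hw n _).2 // scalerDr !scalerA mulrC.
    rewrite opprD addrACA subrr addr0 linear_sum scaler_sumr -sumrB => h1;
      rewrite -[RHS]h1.
    apply: eq_bigr => j _; rewrite linearZ /= (hw j _).2 ?scalerA; last first.
      by rewrite ltnW // ltnS ltn_ord.
    by rewrite mulrBr scalerBl (mulrC (th n)).
  by rewrite mulf_eq0 subr_eq0 (negPf (hth i n _)) ?orbF ?lin //=.
move=> i; rewrite ltnS leq_eqVlt => /predU1P[->|]; last exact: a0.
move: h0; rewrite big1 => [|j _]; last by rewrite a0 // scale0r.
by rewrite add0r => /eqP; rewrite scaler_eq0 (negPf (hw n _).1) // orbF => /eqP.
Qed.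

End Eigenbasis.

Section Chain.
Variables (F : numFieldType) (U : vectType F).
Implicit Types (X Y Z : 'End(U)) (w : nat -> U).

(** The sign [e] will be (-1)^r for an irreducible module with endpoint r. *)
Definition chain_eigval (d : nat) (e : F) (k : nat) : F :=
  e * (-1) ^+ k * (d%:R - 2 * k%:R).

Definition chain_coef (d k : nat) : F := k%:R * (d%:R + 1 - k%:R).

(* In the recurrences k.-1 is harmless at k = 0, where chain_coef vanishes. *)
Definition is_chain d e X Y Z w : Prop :=
  [/\ w 0%N != 0, forall k, X (w k) = chain_eigval d e k *: w k,
      forall k, Y (w k) = w k.+1 + chain_coef d k *: w k.-1
    & forall k, Z (w k) =
        (e * (-1) ^+ k) *: (w k.+1 - chain_coef d k *: w k.-1)].

Definition in_chain d e X Y Z : Prop := exists w, is_chain d e X Y Z w.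

Lemma chain_coef0 d : chain_coef d 0 = 0.
Proof. exact: mul0r. Qed.

Lemma chain_coef_neq0 d k : (0 < k <= d)%N -> chain_coef d k != 0.
Proof.
case/andP=> k0 kd; rewrite mulf_neq0 ?pnatr_eq0 -?lt0n //.
by rewrite natr1 -natrB ?pnatr_eq0 ?leqW // subn_eq0 -ltnNge ltnS.
Qed.

(** Equal values at indices of the same parity force i = j; at opposite parities they force i + j =
    d, impossible for even d. The range reaches d + 1 for use in [chain_end]. *)
Lemma chain_eigval_inj d e (i j : nat) :
  ~~ odd d -> e != 0 -> (i < j < d.+2)%N ->
    chain_eigval d e i != chain_eigval d e j.
Proof.
move=> dN e0 /andP[ij jd]; apply/eqP;
  rewrite /chain_eigval -!mulrA => /(mulfI e0).
have E k : (-1) ^+ k * (d%:R - 2 * k%:R) =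
  ((-1) ^+ k * (d%:Z - 2 * k%:Z))%:~R :> F.
  by rewrite rmorphM rmorphXn rmorphB rmorphM.
rewrite !E => /intr_inj; rewrite -signr_odd -[in RHS]signr_odd.
by case oi: (odd i); case oj: (odd j); rewrite ?expr0 ?expr1; lia.
Qed.

Section FixChain.
Variables (d : nat) (e : F) (X Y Z : 'End(U)) (w : nat -> U).
Hypotheses (e2 : e * e = 1) (hc : is_chain d e X Y Z w).

Let sg2 k : (e * (-1) ^+ k) * (e * (-1) ^+ k) = 1.
Proof. by rewrite mulrACA e2 mul1r -expr2 sqrr_sign. Qed.

Let sign_cases : e = 1 \/ e = -1.
Proof. by have /eqP := e2; rewrite -expr2 sqrf_eq1 => /orP[]/eqP;
  [left|right]. Qed.

Let unit_sign k : e * (-1) ^+ k = 1 \/ e * (-1) ^+ k = -1.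
Proof.
by have /eqP := sg2 k; rewrite -expr2 sqrf_eq1 => /orP[]/eqP; [left|right].
Qed.

(** Subtracting the signed recurrence of [Z] from that of [Y] leaves [2 * chain_coef d k] times
    [w k.-1], so no first zero can occur up to d. *)
Lemma chain_neq0 k : (k <= d)%N -> w k != 0.
Proof.
case: hc => w0 hX hY hZ; elim: k => [|k IHk] // kd; apply/eqP => wk0.
have /eqP : (2 * chain_coef d k.+1) *: w k = 0.
  have -> : (2 * chain_coef d k.+1) *: w k
      = Y (w k.+1) - (e * (-1) ^+ k.+1) *: Z (w k.+1).
    rewrite hY hZ scalerA sg2 /=; apply: scalar_ext => f.
    by rewrite !(linearD, linearZ, linearN) /=; ring.
  by rewrite wk0 !linear0 addr0.
rewrite scaler_eq0 (negPf (IHk (ltnW kd))) orbF mulf_eq0 pnatr_eq0 /=.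
by rewrite (negPf (chain_coef_neq0 _)).
Qed.

Hypotheses (dN : ~~ odd d) (dimU : \dim {:U} = d.+1).

Let e0 : e != 0.
Proof. by apply: contra_eq_neq e2 => ->; rewrite mul0r eq_sym oner_neq0. Qed.

(** Otherwise [w 0], ..., [w d.+1] would be d + 2 eigenvectors for distinct eigenvalues in dimension
    d + 1. *)
Lemma chain_end : w d.+1 = 0.
Proof.
apply/eqP; apply: contraT => wd.
have : free [tuple w i | i < d.+2].
  apply/freeP => k; under eq_bigr => i _ do rewrite nth_mktuple.
  move=> h l; rewrite -[l]inord_val.
  apply: (@eigenvectors_free _ _ X w (chain_eigval d e) d.+2 _ _ (fun i =>
    k (inord i))) => //.
  - move=> j; rewrite ltnS leq_eqVlt => jd; split; last by case: hc.
    by case/predU1P: jd => [->|] //; exact: chain_neq0.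
  - by move=> j m; exact: chain_eigval_inj.
  - by rewrite -[RHS]h; apply: eq_bigr => j _; rewrite inord_val.
rewrite /free size_tuple => /eqP ds.
have := dimvS (subvf <<[tuple w i | i < d.+2]>>%VS).
by rewrite ds dimU ltnn.
Qed.

Definition chain_basis : (\dim {:U}).-tuple U := [tuple w i | i < \dim {:U}].

Lemma nth_chain_basis k : (k < \dim {:U})%N -> chain_basis`_k = w k.
Proof. by move=> kd; rewrite -[k]/(nat_of_ord (Ordinal kd)) nth_mktuple. Qed.

Lemma chain_basisP : basis_of {:U} chain_basis.
Proof.
rewrite basisEfree subvf size_tuple leqnn /= andbT.
apply/(@freeP _ _ _ chain_basis) => k;
  under eq_bigr => i _ do rewrite (nth_chain_basis (ltn_ord i)).
have lt0 : (0 < \dim {:U})%N by rewrite dimU.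
move=> h i; pose a j := k (insubd (Ordinal lt0) j).
have ak (j : 'I__) : a j = k j by rewrite /a valKd.
rewrite -ak;
  apply: (@eigenvectors_free _ _ X w (chain_eigval d e) (\dim {:U}) _ _ a) =>
  //.
- by move=> j; rewrite dimU => jd; split; [exact: (chain_neq0 jd)|case: hc].
- move=> j l /andP[jl]; rewrite dimU => ld; apply: chain_eigval_inj => //.
  by rewrite jl ltnW.
- by rewrite -[RHS]h; apply: eq_bigr => j _; rewrite ak.
Qed.

(** The boundary index k = d + 1, where [w k] vanishes, is included to cover the raising term at the
    last basis vector. *)
Lemma coord_chain_basis (i : 'I_(\dim {:U})) k :
  (k <= \dim {:U})%N -> coord chain_basis i (w k) = (i == k :> nat)%:R.
Proof.
rewrite leq_eqVlt => /orP[/eqP kE|kd].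
  have -> : w k = 0 by rewrite kE dimU chain_end.
  by rewrite linear0 ltn_eqF // kE.
rewrite -(nth_chain_basis kd) -[k]/(nat_of_ord (Ordinal kd)) coord_free.
  by rewrite eq_sym.
by case/andP: chain_basisP.
Qed.

Lemma chain_ext (f g : 'End(U)) : (forall k, f (w k) = g (w k)) -> f = g.
Proof.
move=> h; apply/lfunP => u; rewrite (coord_basis chain_basisP (memvf u)).
by rewrite !linear_sum; apply: eq_bigr => i _;
  rewrite !linearZ /= nth_chain_basis ?ltn_ord // h.
Qed.

(** This shape covers [Y], with s = 1 and t = 1, and [Z], with s the alternating sign and t = -1. *)
Lemma chain_irred_tridiagonal (s : nat -> F) (t : F) (f : 'End(U)) :
  (forall k, s k != 0) -> t != 0 ->
  (forall k, f (w k) = s k *: (w k.+1 + (t * chain_coef d k) *: w k.-1)) ->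
  irred_tridiagonal (mx_in_basis chain_basis f).
Proof.
move=> s0 t0 hf.
have E (i j : 'I_(\dim {:U})) : mx_in_basis chain_basis f i j =
    s j * ((i == j.+1 :> nat)%:R + t * chain_coef d j * (i == j.-1 :> nat)%:R).
  rewrite mxE nth_chain_basis ?ltn_ord // hf linearZ linearD linearZ /=.
  by rewrite !coord_chain_basis // (leq_trans (leq_pred _)) // ltnW.
split=> i j; rewrite E.
  apply: contra_neqT => h.
  case: eqP => [ij|_]; first by move: h; rewrite ij !leqnn /= ltnW ?leqnSn.
  case: eqP => [ij|_]; last by rewrite !mulr0 addr0 mulr0.
  (* At j = 0 the truncated [j.-1] is j itself, but [chain_coef] vanishes there. *)
  case j0: (j == 0%N :> nat);
    first by rewrite (eqP j0) chain_coef0 mulr0 mul0r addr0 mulr0.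
  by exfalso; lia.
case/orP => /eqP ij; rewrite mulf_neq0 // ij.
  rewrite eqxx; case: (j.+1 =P j.-1) => [h|_];
    last by rewrite mulr0 addr0 oner_neq0.
  by exfalso; lia.
case: (nat_of_ord i =P i.+2) => [h|_]; first by exfalso; lia.
rewrite /= eqxx mulr1 add0r mulf_neq0 // chain_coef_neq0 //=.
by rewrite -ij -ltnS -dimU.
Qed.

Lemma chain_leonard_basis : leonard_basis X Y Z chain_basis.
Proof.
case: hc => w0 hX hY hZ; split; first exact: chain_basisP.
- apply/is_diag_mxP => i j ij; rewrite mxE nth_chain_basis // hX linearZ /=.
  by rewrite coord_chain_basis ?(ltnW (ltn_ord _)) // (negPf ij) mulr0.
- apply: (@chain_irred_tridiagonal (fun=> 1) 1) => // [_||k];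
  rewrite ?oner_neq0 //.
  by rewrite hY scale1r mul1r.
- apply: (@chain_irred_tridiagonal (fun k => e * (-1) ^+ k) (-1)) => [k||k].
  + by rewrite mulf_neq0 // signr_eq0.
  + by rewrite oppr_eq0 oner_neq0.
  + by rewrite hZ mulN1r scaleNr.
Qed.

(** The eigenvalues along the chain are distinct, so comparing coordinates of [X v] leaves only one
    nonzero coordinate of [v]. This identifies the diagonal entries in an arbitrary Leonard
    basis. *)
Lemma chain_eigenvector (lam : F) (v : U) : v != 0 -> X v = lam *: v ->
  exists k, [/\ (k <= d)%N, lam = chain_eigval d e k & exists a, v = a *: w k].
Proof.
case: hc => w0 hX hY hZ v0 hv.
have vE := coord_basis chain_basisP (memvf v).
have ha i : coord chain_basis i v * chain_eigval d e i =
  lam * coord chain_basis i v.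
  have : coord chain_basis i (X v) = lam * coord chain_basis i v.
    by rewrite hv linearZ.
  move=> <-; rewrite {2}vE !linear_sum (bigD1 i) //= big1 => [|j ji].
    rewrite addr0 !linearZ /= nth_chain_basis // hX linearZ /=.
    by rewrite coord_chain_basis ?eqxx ?mulr1 // ltnW.
  rewrite !linearZ /= nth_chain_basis // hX linearZ /=.
  rewrite coord_chain_basis ?(ltnW (ltn_ord _)) // eq_sym.
  by rewrite (negPf (ji : nat_of_ord j != i)) !mulr0.
have [i ai] : exists i, coord chain_basis i v != 0.
  apply/existsP; apply: contraNT v0; rewrite negb_exists => /forallP h.
  by rewrite vE big1 // => i _; have := h i; rewrite negbK => /eqP ->;
    rewrite scale0r.
have lamE : lam = chain_eigval d e i.
  by apply: (mulfI ai); rewrite ha mulrC.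
have id (j : 'I_(\dim {:U})) : (j <= d)%N by have := ltn_ord j;
  rewrite [X in (_ < X)%N]dimU.
exists i; split=> //; exists (coord chain_basis i v).
rewrite {1}vE (bigD1 i) //= big1 => [|j ji];
  first by rewrite addr0 nth_chain_basis.
have /eqP := ha j; rewrite lamE mulrC -subr_eq0 -mulrBl mulf_eq0 subr_eq0.
suff /negPf -> : chain_eigval d e j != chain_eigval d e i.
  by move=> /eqP ->; rewrite scale0r.
have [lt|lt|/val_inj E] := ltngtP j i; last by rewrite E eqxx in ji.
  by apply: chain_eigval_inj; rewrite // lt ltnS ltnW // ltnS.
by rewrite eq_sym; apply: chain_eigval_inj; rewrite // lt ltnS ltnW // ltnS.
Qed.

Lemma chain_anticomm12 : forall u, X (Y u) + Y (X u) = 2 *: Z u.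
Proof.
move=> u; suff /lfunP/(_ u) : ((X \o Y) + (Y \o X))%VF = 2 *: Z.
  by rewrite !(add_lfunE, comp_lfunE, scale_lfunE, id_lfunE).
case: hc => w0 hX hY hZ; apply: chain_ext => k.
rewrite !(add_lfunE, comp_lfunE, scale_lfunE, id_lfunE); rewrite hX hY hZ;
  apply: scalar_ext => f.
rewrite !(linearD, linearZ, linearN) /= !hX !hY.
case: k => [|k]; rewrite ?chain_coef0 /= !(linearD, linearZ, linearN) /=;
  rewrite /chain_eigval /chain_coef -!natr1 !exprS; ring.
Qed.

Lemma chain_anticomm13 : forall u, X (Z u) + Z (X u) = 2 *: Y u.
Proof.
move=> u; suff /lfunP/(_ u) : ((X \o Z) + (Z \o X))%VF = 2 *: Y.
  by rewrite !(add_lfunE, comp_lfunE, scale_lfunE, id_lfunE).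
case: hc => w0 hX hY hZ; apply: chain_ext => k.
rewrite !(add_lfunE, comp_lfunE, scale_lfunE, id_lfunE); rewrite hX hY hZ;
  apply: scalar_ext => f.
rewrite !(linearD, linearZ, linearN) /= !hX !hZ.
case: k => [|k]; rewrite ?chain_coef0 /= !(linearD, linearZ, linearN) /=;
  rewrite /chain_eigval /chain_coef -!natr1 !(exprS, expr0, mulr1).
  (* The square of the sign occurs here, so both signs are checked. *)
  by case: sign_cases => ->; ring.
by rewrite !(mulN1r, mulrN, mulNr, opprK); case: (unit_sign k) => ->; ring.
Qed.

Lemma chain_anticomm23 : forall u, Y (Z u) + Z (Y u) = 2 *: X u.
Proof.
move=> u; suff /lfunP/(_ u) : ((Y \o Z) + (Z \o Y))%VF = 2 *: X.
  by rewrite !(add_lfunE, comp_lfunE, scale_lfunE, id_lfunE).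
case: hc => w0 hX hY hZ; apply: chain_ext => k.
rewrite !(add_lfunE, comp_lfunE, scale_lfunE, id_lfunE); rewrite hX hY hZ;
  apply: scalar_ext => f.
rewrite !(linearD, linearZ, linearN) /= !hY !hZ.
case: k => [|k]; rewrite ?chain_coef0 /= !(linearD, linearZ, linearN) /=;
  rewrite /chain_eigval /chain_coef -!natr1 !exprS; ring.
Qed.

(** In [in_chain_swap12] this evaluates X^2 + Z^2 on eigenvectors of [Y]. *)
Lemma chain_casimir :
  forall u, X (X u) + Y (Y u) + Z (Z u) = (d%:R * (d%:R + 2)) *: u.
Proof.
move=> u; suff /lfunP/(_ u) :
    ((X \o X) + (Y \o Y) + (Z \o Z))%VF = (d%:R * (d%:R + 2)) *: \1%VF.
  by rewrite !(add_lfunE, comp_lfunE, scale_lfunE, id_lfunE).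
case: hc => w0 hX hY hZ; apply: chain_ext => k.
rewrite !(add_lfunE, comp_lfunE, scale_lfunE, id_lfunE); rewrite hX hY hZ;
  apply: scalar_ext => f.
rewrite !(linearD, linearZ, linearN) /= !hX !hY !hZ.
case: k => [|k]; rewrite ?chain_coef0 /= !(linearD, linearZ, linearN) /=;
  rewrite /chain_eigval /chain_coef -!natr1 !(exprS, expr0, mulr1).
  by case: sign_cases => ->; ring.
by rewrite !(mulN1r, mulrN, mulNr, opprK); case: (unit_sign k) => ->; ring.
Qed.

End FixChain.
End Chain.

(** * Permuting the three operators of a chain *)

Section LeonardPair.
Variables (F : numFieldType) (U : vectType F).
Implicit Types (X Y Z : 'End(U)) (b : (\dim {:U}).-tuple U).

(** Factors with s_(k+1) = e (-1)^k s_k absorb the sign of [Z]. Consecutive signs are opposite, so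
    its lowering term turns from minus to plus, and [Y] takes over the sign. *)
Lemma in_chain_swap23 d e X Y Z :
  e * e = 1 -> in_chain d e X Y Z -> in_chain d e X Z Y.
Proof.
move=> e2 [w [w0 hX hY hZ]].
pose s := fix s k : F := if k is k'.+1 then e * (-1) ^+ k' * s k' else 1.
have sg2 k : (e * (-1) ^+ k) * (e * (-1) ^+ k) = 1.
  by rewrite mulrACA e2 mul1r -expr2 sqrr_sign.
exists (fun k => s k *: w k); split => [|k|k|k].
- by rewrite scale1r.
- by rewrite linearZ /= hX !scalerA mulrC.
- rewrite linearZ /= hZ; apply: scalar_ext => f.
  rewrite !(linearD, linearZ, linearN) /=.
  case: k => [|k] /=; first by rewrite chain_coef0; ring.
  rewrite !exprS !mulN1r !mulrN; have := sg2 k; move: (e * (-1) ^+ k) => t t2.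
     by ring: t2.
- rewrite linearZ /= hY; apply: scalar_ext => f.
  rewrite !(linearD, linearZ, linearN) /=.
  case: k => [|k] /=.
    by rewrite chain_coef0 expr0 mulr1; ring: e2.
  rewrite !exprS !mulN1r !mulrN; have := sg2 k; move: (e * (-1) ^+ k) => t t2.
     by ring: t2.
Qed.

Section SwapXY.
Variables (d : nat) (e : F) (X Y Z : 'End(U)) (w : nat -> U).
Hypotheses (e2 : e * e = 1) (hc : is_chain d e X Y Z w).
Hypotheses (dN : ~~ odd d) (dimU : \dim {:U} = d.+1).

Let sg2 k : (e * (-1) ^+ k) * (e * (-1) ^+ k) = 1.
Proof. by rewrite mulrACA e2 mul1r -expr2 sqrr_sign. Qed.

(** With these coefficients the neighbours of [w k] contribute e k a_k and e (d - k) a_k to the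
    coefficient of [w k] in [Y v0], in total e d a_k. *)
Let a k : F := e ^+ k / k`!%:R.

Let aS k : a k = e * k.+1%:R * a k.+1.
Proof.
rewrite /a exprS factS natrM -[LHS]mul1r -e2.
field; rewrite addrC natr1 !pnatr_eq0 -lt0n fact_gt0 /= andbT.
by apply: contra_eq_neq e2 => ->; rewrite mul0r eq_sym oner_neq0.
Qed.

Let v0 : U := \sum_(k < d.+1) a k *: w k.

Let chain_coefS k : chain_coef F d k.+1 = k.+1%:R * (d%:R - k%:R).
Proof. by rewrite /chain_coef -natr1; ring. Qed.

Let Y_v0 : Y v0 = (e * d%:R) *: v0.
Proof.
case: hc => w0 hX hY hZ.
(* Partial sums leave two boundary terms. At n = d both vanish, because [w d.+1] and
   [chain_coef F d d.+1] are zero. *)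
have P n : Y (\sum_(k < n.+1) a k *: w k) =
    (e * d%:R) *: (\sum_(k < n.+1) a k *: w k) + a n *: w n.+1
    - (chain_coef F d n.+1 * a n.+1) *: w n.
  elim: n => [|n IHn].
    rewrite !big_ord1 linearZ /= hY (aS 0) chain_coefS chain_coef0.
    apply: scalar_ext => f; rewrite !(linearD, linearZ, linearN) /=.
    by ring: e2.
  rewrite big_ord_recr !linearD /= IHn !linearZ /= hY.
  apply: scalar_ext => f; rewrite !(linearD, linearZ, linearN) /=.
  rewrite (aS n) (aS n.+1) !chain_coefS -!natr1.
  by ring: e2.
rewrite /v0 P (chain_end e2 hc) // scaler0 addr0.
by rewrite chain_coefS subrr mulr0 mul0r scale0r subr0.
Qed.

(** This is the bottom of the new chain: the lowering operator X - eZ kills [v0]. *)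
Let XZ_v0 : X v0 = e *: Z v0.
Proof.
case: hc => w0 hX hY hZ.
have P n : X (\sum_(k < n.+1) a k *: w k) =
  e *: Z (\sum_(k < n.+1) a k *: w k) +
    (-1) ^+ n *: ((chain_coef F d n.+1 * a n.+1) *: w n - a n *: w n.+1).
  elim: n => [|n IHn].
    rewrite !big_ord1 !linearZ /= hX hZ (aS 0) chain_coefS chain_coef0.
    apply: scalar_ext => f; rewrite !(linearD, linearZ, linearN) /=.
    rewrite /chain_eigval !expr0; by ring: e2.
  rewrite big_ord_recr !linearD /= IHn !linearZ /= hX hZ.
  apply: scalar_ext => f; rewrite !(linearD, linearZ, linearN) /=.
  rewrite /chain_eigval (aS n) (aS n.+1) !chain_coefS -!natr1 !exprS.
  by ring: e2.
rewrite /v0 P (chain_end e2 hc) // scaler0 subr0.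
by rewrite chain_coefS subrr mulr0 mul0r scale0r scaler0 addr0.
Qed.

Lemma in_chain_swap12 : in_chain d e Y X Z.
Proof.
case: (hc) => w0 hX hY hZ.
have r12 := chain_anticomm12 e2 hc dN dimU.
have r13 := chain_anticomm13 e2 hc dN dimU.
have r23 := chain_anticomm23 e2 hc dN dimU.
have cas := chain_casimir e2 hc dN dimU.
pose v := fix v k : U :=
  if k is k'.+1 then 2^-1 *: (X (v k') + (e * (-1) ^+ k') *: Z (v k')) else v0.
have vE k : X (v k) + (e * (-1) ^+ k) *: Z (v k) = 2 *: v k.+1.
  by rewrite scalerA mulfV ?pnatr_eq0 // scale1r.
(* Put t = e (-1)^k. On a [Y]-eigenvector for theta, the relations give Y (X + tZ) = (2t - theta) (X
   + tZ), and 2t - theta_k = theta_(k+1). *)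
have hYv k : Y (v k) = chain_eigval d e k *: v k.
  elim: k => [|k IHk].
    by rewrite Y_v0 /chain_eigval expr0 mulr1 mulr0 subr0.
  have E1 : Y (X (v k)) = 2 *: Z (v k) - chain_eigval d e k *: X (v k).
    by rewrite -r12 IHk linearZ /= addrAC subrr add0r.
  have E2 : Y (Z (v k)) = 2 *: X (v k) - chain_eigval d e k *: Z (v k).
    by rewrite -r23 IHk linearZ /= addrK.
  rewrite /= !(linearD, linearZ) /= E1 E2; apply: scalar_ext => f.
  rewrite !(linearD, linearZ, linearN) /= /chain_eigval exprS mulN1r mulrN
    -natr1.
  by have := sg2 k; move: (e * (-1) ^+ k) => t t2; ring: t2.
(* For k > 0 the sign has flipped, so this is, up to a factor 2, the operator that produced [v k].
   Its square is X^2 + Z^2 plus a sign times 2Y, hence scalar on the preceding vector by the Casimir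
   identity. *)
have vB k : X (v k) - (e * (-1) ^+ k) *: Z (v k) =
  (2 * chain_coef F d k) *: v k.-1.
  case: k => [|k].
    by rewrite chain_coef0 mulr0 scale0r /= XZ_v0 expr0 mulr1 subrr.
  have E1 : X (X (v k)) = (d%:R * (d%:R + 2)) *: v k - Z (Z (v k))
      - chain_eigval d e k *: (chain_eigval d e k *: v k).
    rewrite -cas;
      have -> : Y (Y (v k)) = chain_eigval d e k *: (chain_eigval d e k *: v k).
      by rewrite hYv linearZ /= hYv.
    by rewrite addrK addrK.
  have E2 : X (Z (v k)) = (2 * chain_eigval d e k) *: v k - Z (X (v k)).
    by rewrite -scalerA -hYv -r13 addrK.
  rewrite /= !(linearD, linearZ) /= E1 E2; apply: scalar_ext => f.
  rewrite !(linearD, linearZ, linearN) /= /chain_eigval chain_coefS exprS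
    mulN1r mulrN.
  by have := sg2 k; move: (e * (-1) ^+ k) => t t2; field: t2.
have v0E : v 0%N = v0 by [].
clearbody v; exists v; split => [|//|k|k].
(* The coordinate of [v0] at [w 0] is a_0 = 1. *)
- rewrite v0E; apply/eqP => v00.
  have lt0 : (0 < \dim {:U})%N by rewrite dimU.
  have /eqP := congr1 (coord (chain_basis w) (Ordinal lt0)) v00.
  rewrite /= linear0 linear_sum /= big_ord_recl /= linearZ /=.
  rewrite (coord_chain_basis e2 hc) //= big1 => [|i _].
    by rewrite addr0 /a expr0 fact0 divr1 mulr1 oner_eq0.
  rewrite linearZ /= (coord_chain_basis e2 hc) ?mulr0 //.
  by rewrite dimU ltnW // ltnS ltn_ord.
(* The two recurrences are the half sum and, with the sign, the half difference of [vE] and [vB]. *)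
- have := congr2 +%R (vE k) (vB k); rewrite addrACA subrr addr0 => h.
  apply: (scalerI (a := 2)); first by rewrite pnatr_eq0.
  by rewrite scalerDr scalerA -h scaler_nat mulr2n.
- have h : (e * (-1) ^+ k) *: (2 *: v k.+1 - (2 * chain_coef F d k) *: v k.-1)
  = 2 *: Z (v k).
    rewrite -vE -vB; apply: scalar_ext => f.
    rewrite !(linearD, linearZ, linearN) /=; have := sg2 k.
    by move: (e * (-1) ^+ k) => t t2; ring: t2.
  apply: (scalerI (a := 2)); first by rewrite pnatr_eq0.
  by rewrite -h; apply: scalar_ext => f;
    rewrite !(linearD, linearZ, linearN) /=; ring.
Qed.

End SwapXY.

(** * Arbitrary Leonard bases of a chain triple *)

Section LeonardProperties.
Variables (d : nat) (e : F) (X Y Z : 'End(U)).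
Hypotheses (e2 : e * e = 1) (dN : ~~ odd d) (dimU : \dim {:U} = d.+1).
Hypothesis (hc : in_chain d e X Y Z).

Lemma in_chain_leonard_basis : exists b, leonard_basis X Y Z b.
Proof. by case: hc => w hw; exists (chain_basis w);
  apply: (chain_leonard_basis e2 hw). Qed.

Lemma diag_coord b (i : 'I_(\dim {:U})) u :
    basis_of {:U} b -> is_diag_mx (mx_in_basis b X) ->
  coord b i (X u) = mx_in_basis b X i i * coord b i u.
Proof.
move=> hb /is_diag_mxP hd.
rewrite {1}(coord_basis hb (memvf u)) !linear_sum (bigD1 i) //= big1 => [|j ji].
  by rewrite addr0 !linearZ /= mxE mulrC.
rewrite !linearZ /=; have := hd i j; rewrite mxE => ->; first by rewrite mulr0.
by rewrite eq_sym.
Qed.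

Lemma diag_eigenvector b (j : 'I_(\dim {:U})) :
    basis_of {:U} b -> is_diag_mx (mx_in_basis b X) ->
  X b`_j = mx_in_basis b X j j *: b`_j.
Proof.
move=> hb hd;
  rewrite (coord_basis hb (memvf (X b`_j))) (bigD1 j) //= big1 => [|i ij].
  by rewrite addr0 mxE.
by rewrite diag_coord // coord_free ?(basis_free hb) // eq_sym (negPf ij) mulr0
  scale0r.
Qed.

Lemma basis_neq0 b (i : 'I_(\dim {:U})) : basis_of {:U} b -> b`_i != 0.
Proof.
move=> hb; apply/eqP => b0; have /eqP := coord_free i i (basis_free hb).
by rewrite b0 linear0 eqxx eq_sym oner_eq0.
Qed.

Lemma basis_anticomm b (i j : 'I_(\dim {:U})) :
    basis_of {:U} b -> is_diag_mx (mx_in_basis b X) ->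
  let lam k := mx_in_basis b X k k in
  (lam i + lam j) * mx_in_basis b Y i j = 2 * mx_in_basis b Z i j /\
  (lam i + lam j) * mx_in_basis b Z i j = 2 * mx_in_basis b Y i j.
Proof.
move=> hb hd lam; case: hc => w hw.
have h12 := chain_anticomm12 e2 hw dN dimU b`_j.
have h13 := chain_anticomm13 e2 hw dN dimU b`_j.
have := congr1 (coord b i) h12; have := congr1 (coord b i) h13.
rewrite (diag_eigenvector j hb hd) !(linearD, linearZ) /= !diag_coord // -/(lam
  i) -/(lam j) => E1 E2.
rewrite ![mx_in_basis b Y i j]mxE ![mx_in_basis b Z i j]mxE -E1 -E2.
by split; ring.
Qed.

(** With s the sum of the two diagonal entries, the two relations give s^2 Y_ij = 2 s Z_ij = 4
    Y_ij. *)
Lemma basis_entries_neq0 b (i j : 'I_(\dim {:U})) :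
    basis_of {:U} b -> is_diag_mx (mx_in_basis b X) ->
      mx_in_basis b Y i j != 0 ->
  (mx_in_basis b X i i + mx_in_basis b X j j) ^+ 2 = 2 ^+ 2.
Proof.
move=> hb hd Y0; have [h1 h2] := basis_anticomm i j hb hd.
by apply: (mulIf Y0); rewrite !expr2 -!mulrA h1 mulrCA h2.
Qed.

Lemma in_chain_zero_diagonals : zero_diagonals X Y Z.
Proof.
move=> b [hb hd _ _]; suff h i : mx_in_basis b Y i i = 0.
  split=> i //; have [h1 _] := basis_anticomm i i hb hd.
  have := h i; move: h1 => /[swap] ->; rewrite mulr0 => /esym/eqP.
  by rewrite mulf_eq0 pnatr_eq0 => /eqP.
apply/eqP; apply: contraT => /(basis_entries_neq0 hb hd) /eqP.
case: (hc) => w hw.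
have [k [kd -> _]] :=
  chain_eigenvector e2 hw dN dimU (basis_neq0 i hb) (diag_eigenvector i hb hd).
have -> : chain_eigval d e k + chain_eigval d e k =
  2 * chain_eigval d e k by ring.
(* Cancelling 4 leaves theta^2 = 1, whereas theta is up to sign the even integer d - 2k. *)
rewrite exprMn -subr_eq0 -{2}[2 ^+ 2]mulr1 -mulrBr mulf_eq0 sqrf_eq0 pnatr_eq0
  /=.
rewrite /chain_eigval !exprMn sqrr_sign expr2 e2 !mul1r subr_eq0.
have -> : (d%:R - 2 * k%:R) ^+ 2 = ((d%:Z - 2 * k%:Z) ^+ 2)%:~R :> F.
  by rewrite rmorphXn rmorphB rmorphM.
rewrite -[1]/(1%:~R) eqr_int sqrf_eq1.
by case/orP => /eqP h; lia.
Qed.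

Lemma in_chain_bannai_ito : bannai_ito_type X Y Z.
Proof.
move=> b theta [hb hd [_ hY] _] hth i i2 id.
case: (hc) => w hw.
have lamE (j : 'I_(\dim {:U})) : mx_in_basis b X j j = theta j.
  by rewrite mxE hth // linearZ /= coord_free ?(basis_free hb) // eqxx mulr1.
have thS j : (j.+1 < \dim {:U})%N -> (theta j + theta j.+1) ^+ 2 = 2 ^+ 2.
  move=> jd; rewrite -[j.+1]/(nat_of_ord (Ordinal jd)).
  rewrite -[X in theta X + _]/(nat_of_ord (Ordinal (ltnW jd))) -!lamE.
  by apply: basis_entries_neq0 => //; apply: hY; rewrite /= eqxx orbT.
(* A repeated value would put two basis vectors on the line of a single [w m]. *)
have thI j k : (j < k < \dim {:U})%N -> theta j != theta k.
  case/andP=> jk kd; apply/eqP => E.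
  have jd := ltn_trans jk kd.
  have [m [md mE [a aE]]] := chain_eigenvector e2 hw dN dimU
    (basis_neq0 (Ordinal jd) hb) (hth j jd).
  have [n [nd nE [c cE]]] := chain_eigenvector e2 hw dN dimU
    (basis_neq0 (Ordinal kd) hb) (hth k kd).
  have mn : m = n.
    apply/eqP; case: ltngtP => // lt.
      have := @chain_eigval_inj F d e m n dN; rewrite -mE -nE E eqxx.
      by rewrite lt ltnS ltnW // => /(_ _ isT); apply;
        apply: contra_eq_neq e2 => ->; rewrite mul0r eq_sym oner_neq0.
    have := @chain_eigval_inj F d e n m dN; rewrite -mE -nE E eqxx.
    by rewrite lt ltnS ltnW // => /(_ _ isT); apply;
      apply: contra_eq_neq e2 => ->; rewrite mul0r eq_sym oner_neq0.
  move: (basis_neq0 (Ordinal kd) hb); rewrite /= cE -mn.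
  have /eqP := coord_free (Ordinal kd) (Ordinal jd) (basis_free hb).
  rewrite /= cE -mn => h0;
    have := coord_free (Ordinal jd) (Ordinal jd) (basis_free hb).
  move: h0; rewrite /= aE !linearZ /= eqxx -(inj_eq val_inj) /= gtn_eqF //.
  rewrite mulf_eq0 => /orP[/eqP-> _|/eqP->]; first by rewrite scale0r eqxx.
  by move=> /eqP; rewrite mulr0 eq_sym oner_eq0.
case: i i2 id => [|[|i]] //= _ id.
rewrite subn2 /=.
have t0 := thS i (ltnW (ltnW id)).
have t1 := thS i.+1 (ltnW id).
have t2 := thS i.+2 id.
have n0 : theta i != theta i.+2 by apply: thI; rewrite leqnSn /= ltnW.
have n1 : theta i.+1 != theta i.+3 by apply: thI; rewrite leqnSn.
have n2 : theta i.+1 - theta i.+2 != 0 by rewrite subr_eq0; apply: thI;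
  rewrite leqnn ltnW.
move/eqP: t0; move/eqP: t1; move/eqP: t2; rewrite !eqf_sqr.
have same x y z c : x + y = c -> y + z = c -> x = z :> F.
  by move=> <-; rewrite addrC => /addIr.
have flip x y z u c : x + y = c -> z + u = c -> x - u = - (y - z) :> F.
  by move=> /(canRL (addrK _)) -> <-; ring.
(* Two equal consecutive sums would make entries at distance 2 coincide. So the signs alternate, the
   outer sums [t0] and [t2] agree, and subtracting them gives the ratio -1. *)
move=> /orP[]/eqP t2 /orP[]/eqP t1 /orP[]/eqP t0;
  try (by rewrite (same _ _ _ _ t0 t1) eqxx in n0);
  try (by rewrite (same _ _ _ _ t1 t2) eqxx in n1);
  by apply: (mulIf n2); rewrite mulfVK // mulN1r (flip _ _ _ _ _ t0 t2).
Qed.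

End LeonardProperties.
End LeonardPair.

(** * The cube and its characters *)

Section Flip.
Variable D : nat.
Implicit Types (x y z : cube D) (j : 'I_D).

Definition flip j y : cube D := [ffun i => (i == j) (+) y i].

Lemma flipK j : involutive (flip j).
Proof. by move=> y; apply/ffunP => i; rewrite !ffunE addbA addbb. Qed.

Lemma flipC j k y : flip j (flip k y) = flip k (flip j y).
Proof. by apply/ffunP => i; rewrite !ffunE addbCA. Qed.

Lemma flip_same j y : flip j y j = ~~ y j.
Proof. by rewrite ffunE eqxx. Qed.

Lemma flip_other j k y : j != k -> flip j y k = y k.
Proof. by rewrite ffunE eq_sym => /negPf ->. Qed.

Lemma hamming_flip x y j :
  hamming x (flip j y) =
    if x j == y j then (hamming x y).+1 else (hamming x y).-1.
Proof.
have in_flip z : x j == z j -> hamming x (flip j z) = (hamming x z).+1.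
  move=> xz; rewrite /hamming.
  have -> : [set i | x i != flip j z i] = j |: [set i | x i != z i].
    apply/setP => i; rewrite !inE ffunE; case: (eqVneq i j) => [->|//] /=.
    by rewrite (eqP xz); case: (z j).
  by rewrite cardsU1 inE xz.
case: ifP => [/in_flip //|/negbT xy].
(* The remaining case is the first one read backwards from [flip j y]. *)
rewrite -{2}[y](flipK j) (in_flip (flip j y)) //.
by rewrite flip_same; case: (x j) xy; case: (y j).
Qed.

Lemma hamming_eq1 y z : (hamming y z == 1)%N = [exists j, z == flip j y].
Proof.
apply/cards1P/existsP => -[j].
  move=> /setP h; exists j; apply/eqP/ffunP => i; rewrite ffunE.
  by have := h i; rewrite !inE; case: (i == j); case: (y i); case: (z i).
move=> /eqP ->; exists j; apply/setP => i; rewrite !inE ffunE.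
by case: (i == j); case: (y i).
Qed.

Lemma flip_inj y : injective (flip^~ y).
Proof.
move=> j k /ffunP/(_ j); rewrite !ffunE eqxx.
by case: (eqVneq j k) => // _; case: (y j).
Qed.

Lemma big_hamming1 (V : nmodType) (f : cube D -> V) y :
  \sum_(z | hamming y z == 1%N) f z = \sum_j f (flip j y).
Proof.
have -> : \sum_j f (flip j y) = \sum_(j in [set: 'I_D]) f (flip j y).
  by apply: eq_bigl => j; rewrite inE.
rewrite -(big_imset f (h := flip^~ y)) /=; last by move=> j k _ _;
  apply: flip_inj.
apply: eq_bigl => z; rewrite hamming_eq1; apply/existsP/imsetP => -[j].
  by move=> /eqP ->; exists j; rewrite ?inE.
by move=> _ ->; exists j.
Qed.

Lemma hamming_le x y : (hamming x y <= D)%N.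
Proof. by rewrite -[X in (_ <= X)%N]card_ord max_card. Qed.

Lemma card_cube : #|{: cube D}| = (2 ^ D)%N.
Proof. by rewrite card_ffun card_bool card_ord. Qed.

End Flip.

(** * Characters of the cube and the entries of the dual adjacency matrix *)

Section Characters.
Variables (C : numClosedFieldType) (D : nat).
Implicit Types (x y z : cube D) (j : 'I_D) (T : {set 'I_D}).

(** Here [T] is the set of ignored coordinates, the complement of the usual index. The adjacency
    eigenvalue is 2|T| - D, so singletons belong to -(D-2). *)
Definition character T y : C := \prod_j (if j \in T then 1 else (-1) ^+ y j).

Lemma character_flip T j y :
  character T (flip j y) = (if j \in T then 1 else -1) * character T y.
Proof.
rewrite /character (bigD1 j) // [in RHS](bigD1 j) //= mulrA flip_same;
  congr (_ * _).
  by case: ifP => _; rewrite ?mul1r //; case: (y j);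
    rewrite ?expr0 ?expr1 ?mulr1 ?mulrNN ?mulr1.
by apply: eq_bigr => k kj; rewrite flip_other // eq_sym.
Qed.

(** The sum over subsets is an expanded product of factors 1 + (-1)^(y_j + z_j), and a coordinate
    where y and z differ gives a zero factor. *)
Lemma character_complete y z :
  \sum_T character T y * character T z = (if y == z then 2 ^+ D else 0).
Proof.
have -> : \sum_T character T y * character T z =
  \prod_j (1 + (-1) ^+ (y j (+) z j)).
  rewrite bigA_distr; apply: eq_big => [T|T _]; first by rewrite inE.
  rewrite -big_split /=; apply: eq_bigr => j _.
  by case: ifP => _; rewrite ?mulr1 // -signr_addb.
case: eqP => [->|/eqP yz].
  under eq_bigr => j _ do rewrite addbb expr0.
  by rewrite prodr_const card_ord.
have [j /negPf yj] : exists j, y j != z j.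
  apply/existsP; apply: contraNT yz; rewrite negb_exists => /forallP h.
  by apply/eqP/ffunP => j; have := h j; rewrite negbK => /eqP.
rewrite (bigD1 j) //= (_ : y j (+) z j = true) ?expr1 ?subrr ?mul0r //.
by move: yj; case: (y j); case: (z j).
Qed.

Lemma sum_character1 x y :
  \sum_j character [set j] x * character [set j] y =
  (-1) ^+ hamming x y * (D%:R - 2 * (hamming x y)%:R).
Proof.
have sgnE : (-1) ^+ hamming x y = \prod_j (-1) ^+ (x j (+) y j) :> C.
  rewrite (bigID (fun j => x j == y j)) /= big1 => [|j /eqP->];
    last by rewrite addbb.
  rewrite mul1r (eq_bigr (fun=> -1)) => [|j]; last by case: (x j); case: (y j).
  by rewrite prodr_const /hamming cardsE.
(* Each summand is the full sign with its j-th factor removed, so the sum counts agreements minus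
   disagreements. *)
have E j : character [set j] x * character [set j] y =
    (-1) ^+ hamming x y * (-1) ^+ (x j (+) y j).
  rewrite sgnE (bigD1 j) //= mulrAC -expr2 sqrr_sign mul1r.
  rewrite /character -big_split /= (bigD1 j) //= inE eqxx !mul1r.
  by apply: eq_bigr => k kj; rewrite inE (negPf kj) signr_addb.
under eq_bigr => j _ do rewrite E.
rewrite -mulr_sumr; congr (_ * _).
have -> : D%:R = \sum_(j < D) 1 :> C by rewrite sumr_const card_ord.
have -> : (hamming x y)%:R = \sum_j (x j != y j)%:R :> C.
  rewrite /hamming -sum1_card natr_sum big_mkcond /=.
  by apply: eq_bigr => j _; rewrite inE; case: (x j == y j).
rewrite mulr_sumr -sumrB; apply: eq_bigr => j _.
by case: (x j); case: (y j); rewrite /= ?expr0 ?expr1; ring.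
Qed.

Lemma sum_cube (V : nmodType) (f : 'I_#|{: cube D}| -> V) :
  \sum_i f i = \sum_y f (enum_rank y).
Proof. by rewrite (reindex _ (onW_bij _ (enum_rank_bij _))). Qed.

Lemma mx_of_cubeE (f : cube D -> cube D -> C) y z :
  mx_of_cube f (enum_rank y) (enum_rank z) = f y z.
Proof. by rewrite mxE !enum_rankK. Qed.

Lemma adjA_mul m (v : 'M[C]_(_, m)) y k :
  (adjA C D *m v) (enum_rank y) k = \sum_j v (enum_rank (flip j y)) k.
Proof.
rewrite mxE sum_cube -(big_hamming1 (fun z =>
  v (enum_rank z) k)) [RHS]big_mkcond /=.
by apply: eq_bigr => z _; rewrite mx_of_cubeE; case: ifP; rewrite ?mul1r ?mul0r.
Qed.

Lemma diag_of_cube_mul m (f : cube D -> C) (v : 'M[C]_(_, m)) y k :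
  (diag_of_cube f *m v) (enum_rank y) k = f y * v (enum_rank y) k.
Proof.
rewrite mxE sum_cube (bigD1 y) //= big1 => [|z zy].
  by rewrite mx_of_cubeE eqxx addr0.
by rewrite mx_of_cubeE eq_sym (negPf zy) mul0r.
Qed.

(** Since [G] is Hermitian and fixes the rows of [E], the rows of 1 - G are orthogonal to [E]. The
    projection kills them and fixes the rows of [G]. *)
Lemma proj_ortho_unique n p (E : 'M[C]_(p, n)) (G : 'M[C]_n) :
  (G <= E)%MS -> E *m G = E -> map_mx Num.conj G^T = G -> proj_ortho E = G.
Proof.
move=> GE EG Gh.
rewrite -[LHS]mul1mx -[1%:M](subrK G) mulmxDl [G *m _]proj_ortho_id //.
rewrite proj_ortho_0 ?add0r // orthomx_sym; apply/orthomx1P.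
rewrite linearB /= map_mxB mulmxBr Gh EG.
by rewrite trmx1 map_mx1 mulmx1 subrr.
Qed.

Lemma adjA_sym : (adjA C D)^T = adjA C D.
Proof.
apply/matrixP => i k; rewrite !mxE /hamming.
suff -> : [set j | enum_val k j != enum_val i j] =
  [set j | enum_val i j != enum_val k j] by [].
by move=> *; apply/setP => j; rewrite !inE eq_sym.
Qed.

Lemma sum_character_flip T y :
  \sum_j character T (flip j y) = (2 * #|T|%:R - D%:R) * character T y.
Proof.
under eq_bigr => j _ do rewrite character_flip.
rewrite -mulr_suml; congr (_ * _).
have -> : D%:R = \sum_(j < D) 1 :> C by rewrite sumr_const card_ord.
have -> : #|T|%:R = \sum_(j < D) (j \in T)%:R :> C.
  by rewrite -sum1_card natr_sum big_mkcond; apply: eq_bigr => j _;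
    case: (j \in T).
rewrite mulr_sumr -sumrB.
by apply: eq_bigr => j _; case: (j \in T); rewrite /=; ring.
Qed.

Lemma big_card1 (V : nmodType) (f : {set 'I_D} -> V) :
  \sum_(T : {set _} | #|T| == 1%N) f T = \sum_j f [set j].
Proof.
have -> : \sum_j f [set j] = \sum_(j in [set: 'I_D]) f [set j].
  by apply: eq_bigl => j; rewrite inE.
rewrite -(big_imset f (h := set1)) /=; last by move=> j k _ _; apply: set1_inj.
apply: eq_bigl => T; apply/cards1P/imsetP => -[j].
  by move=> ->; exists j; rewrite ?inE.
by move=> _ ->; exists j.
Qed.

(* The Fourier coefficients of an eigenfunction vanish off the characters of
   the same eigenvalue; the characters of -(D-2) are the singletons. *)
Lemma eigenfunction_expansion (f : cube D -> C) :
    (forall y, \sum_j f (flip j y) = - (D%:R - 2) * f y) ->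
  forall y, 2 ^+ D * f y =
    \sum_j (\sum_z f z * character [set j] z) * character [set j] y.
Proof.
move=> hf y; pose c T := \sum_z f z * character T z.
have c0 T : #|T| != 1%N -> c T = 0.
  (* The adjacency operator is moved from [f] to the character by reindexing along [flip j]. *)
  move=> T1; have : - (D%:R - 2) * c T = (2 * #|T|%:R - D%:R) * c T.
    rewrite [LHS]mulr_sumr [RHS]mulr_sumr.
    under eq_bigr => z _ do rewrite mulrA -hf mulr_suml.
    under [RHS]eq_bigr => z _ do rewrite mulrCA -sum_character_flip mulr_sumr.
    rewrite exchange_big [RHS]exchange_big; apply: eq_bigr => j _ /=.
    rewrite (reindex_inj (inv_inj (@flipK D j))) /=.
    by apply: eq_bigr => z _; rewrite flipK.
  move=> /eqP; rewrite -subr_eq0 -mulrBl mulf_eq0 => /orP[|/eqP //].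
  have -> : - (D%:R - 2) - (2 * #|T|%:R - D%:R) =
    2 * (1 - #|T|%:R) :> C by ring.
  by rewrite mulf_eq0 pnatr_eq0 /= subr_eq0 eq_sym pnatr_eq1 (negPf T1).
rewrite -(big_card1 (fun T => c T * character T y)) big_mkcond /=.
have -> : \sum_(T : {set _}) (if #|T| == 1%N then c T * character T y else 0) =
    \sum_T \sum_z f z * (character T z * character T y).
  apply: eq_bigr => T _; under [RHS]eq_bigr => z _ do rewrite mulrA.
  by rewrite -mulr_suml -/(c T); case: ifPn => // /c0 ->; rewrite mul0r.
rewrite exchange_big /= (bigD1 y) //= [X in _ + X]big1 => [|z zy].
  by rewrite addr0 -mulr_sumr character_complete eqxx mulrC.
by rewrite -mulr_sumr character_complete (negPf zy) mulr0.
Qed.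

Lemma character_real T y : Num.conj (character T y) = character T y.
Proof.
rewrite rmorph_prod; apply: eq_bigr => j _.
by case: ifP => _; rewrite ?rmorph1 // rmorph_sign.
Qed.

(** The kernel [G] of the singleton characters is real and symmetric, has its rows in the
    eigenspace, and fixes the eigenspace by [eigenfunction_expansion]; so it is the projection. *)
Lemma idemF1E x y :
  #|{: cube D}|%:R * idemF1 C D (enum_rank x) (enum_rank y) =
  (-1) ^+ hamming x y * (D%:R - 2 * (hamming x y)%:R).
Proof.
pose G : cube_mx C D := mx_of_cube (fun y z =>
  2 ^- D * \sum_j character [set j] y * character [set j] z).
have two0 : 2 ^+ D != 0 :> C by rewrite expf_neq0 // pnatr_eq0.
have GC y' z' : G (enum_rank y') (enum_rank z') =
  G (enum_rank z') (enum_rank y').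
  by rewrite !mx_of_cubeE; congr (_ * _); apply: eq_bigr => j _; rewrite mulrC.
have Gsym : G^T = G.
  by apply/matrixP => k l; rewrite mxE -[k]enum_valK -[l]enum_valK GC.
suff E : proj_ortho (eigenspace (adjA C D)^T (- (D%:R - 2))) = G.
  rewrite /idemF1 /prim_idempotent E Gsym mx_of_cubeE sum_character1 card_cube.
  by rewrite natrX mulrA mulfV ?mul1r.
rewrite adjA_sym; apply: proj_ortho_unique.
- apply/eigenspaceP/trmx_inj; rewrite trmx_mul adjA_sym linearZ /= Gsym.
  apply/matrixP => k l; rewrite -[k]enum_valK -[l]enum_valK adjA_mul mxE.
  move: (enum_val k) (enum_val l) => y' z'.
  under eq_bigr => m _ do rewrite mx_of_cubeE.
  rewrite mx_of_cubeE -mulr_sumr mulrCA; congr (_ * _).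
  rewrite exchange_big mulr_sumr; apply: eq_bigr => m _ /=.
  by rewrite -mulr_suml sum_character_flip cards1 mulr1 opprB mulrA.
- set W := eigenspace _ _; have /eigenspaceP hW : (W <= W)%MS by [].
  apply/matrixP => k l; rewrite -[l]enum_valK; move: (enum_val l) => y'.
  apply: (mulfI two0);
    rewrite (eigenfunction_expansion (f := fun z => W k (enum_rank z))).
    rewrite mxE sum_cube mulr_sumr;
      under [RHS]eq_bigr => j _ do rewrite mulr_suml.
    rewrite exchange_big; apply: eq_bigr => z _ /=.
    rewrite mx_of_cubeE mulrCA mulVKf // mulr_sumr.
    by apply: eq_bigr => j _; rewrite mulrA.
  move=> z;
    have /matrixP/(_ (enum_rank z) k) : (W *m adjA C D)^T =
    (- (D%:R - 2) *: W)^T.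
    by rewrite hW.
  rewrite trmx_mul adjA_sym adjA_mul !mxE => <-.
  by apply: eq_bigr => j _; rewrite [RHS]mxE.
- rewrite Gsym; apply/matrixP => k l; rewrite mxE.
  rewrite -[k]enum_valK -[l]enum_valK mx_of_cubeE rmorphM rmorph_sum fmorphV
    rmorphXn rmorph_nat.
  by congr (_ * _); apply: eq_bigr => j _; rewrite rmorphM /= !character_real.
Qed.

End Characters.

(** * Irreducible modules of the Terwilliger algebra *)

Section RaisingLowering.
Variables (C : numClosedFieldType) (D : nat) (x : cube D).
Local Notation V := (cube_cV C D).
Implicit Types (y : cube D) (u v : V).

Lemma cV_ext u v :
  (forall y, u (enum_rank y) 0 = v (enum_rank y) 0) -> u = v.
Proof. by move=> h; apply/colP => k; rewrite -[k]enum_valK h. Qed.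

(** Flipping a coordinate where y differs from x leads to a neighbour nearer to x, so values move
    outwards by one level. *)
Definition raise v : V :=
  \col_k \sum_(j | x j != (enum_val k : cube D) j)
    v (enum_rank (flip j (enum_val k))) 0.

Definition lower v : V :=
  \col_k \sum_(j | x j == (enum_val k : cube D) j)
    v (enum_rank (flip j (enum_val k))) 0.

Definition on_level i v := forall y, hamming x y != i -> v (enum_rank y) 0 = 0.

Lemma raiseE v y :
  raise v (enum_rank y) 0 = \sum_(j | x j != y j) v (enum_rank (flip j y)) 0.
Proof. by rewrite mxE enum_rankK. Qed.

Lemma lowerE v y :
  lower v (enum_rank y) 0 = \sum_(j | x j == y j) v (enum_rank (flip j y)) 0.
Proof. by rewrite mxE enum_rankK. Qed.

Lemma raiseZ a v : raise (a *: v) = a *: raise v.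
Proof.
apply: cV_ext => y; rewrite raiseE [RHS]mxE raiseE mulr_sumr.
by apply: eq_bigr => j _; rewrite mxE.
Qed.

Lemma raise0 : raise 0 = 0.
Proof. by rewrite -(scale0r 0) raiseZ !scale0r. Qed.

Lemma lower0 : lower 0 = 0.
Proof. by apply: cV_ext => y; rewrite lowerE [RHS]mxE big1 // => j _;
  rewrite mxE. Qed.

Lemma adjA_raise_lower v : adjA C D *m v = raise v + lower v.
Proof.
apply: cV_ext => y; rewrite adjA_mul [RHS]mxE raiseE lowerE addrC.
by rewrite (bigID (fun j => x j == y j)).
Qed.

Lemma hamming_flip_pos y j : x j != y j -> (hamming x (flip j y)).+1 =
  hamming x y.
Proof.
move=> xy; rewrite -{2}[y](flipK j) (hamming_flip x (flip j y)) flip_same.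
by case: (x j) xy; case: (y j).
Qed.

Lemma raise_level i v : on_level i v -> on_level i.+1 (raise v).
Proof.
move=> hv y hy; rewrite raiseE big1 // => j xy; apply: hv.
by apply: contraNneq hy => <-; rewrite (hamming_flip_pos xy).
Qed.

Lemma lower_level i v : on_level i v -> on_level i.-1 (lower v).
Proof.
move=> hv y hy; rewrite lowerE big1 // => j xy; apply: hv.
by apply: contraNneq hy => <-; rewrite hamming_flip xy.
Qed.

Lemma lower_level0 v : on_level 0 v -> lower v = 0.
Proof.
move=> hv; apply: cV_ext => y; rewrite lowerE [RHS]mxE big1 // => j xy;
  apply: hv.
by rewrite hamming_flip xy.
Qed.

Lemma on_level_gt i v : on_level i v -> (D < i)%N -> v = 0.
Proof.
move=> hv iD; apply: cV_ext => y; rewrite [RHS]mxE hv // neq_ltn.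
by rewrite (leq_ltn_trans (hamming_le x y)).
Qed.

(* The sl2 relation: the terms flipping two distinct coordinates cancel. *)
Lemma lower_raise i v : on_level i v ->
  lower (raise v) = raise (lower v) + (D%:R - 2 * i%:R) *: v.
Proof.
move=> hv; apply: cV_ext => y;
  rewrite lowerE [RHS]mxE [in RHS]raiseE [in RHS]mxE.
pose g j k := v (enum_rank (flip k (flip j y))) 0.
have -> : \sum_(j | x j == y j) raise v (enum_rank (flip j y)) 0 =
    \sum_(j | x j == y j) (\sum_(k | (x k != y k)) g j k + v (enum_rank y) 0).
  apply: eq_bigr => j xy; rewrite raiseE (bigD1 j) /=; last first.
    by rewrite flip_same (eqP xy); case: (y j).
  rewrite flipK addrC; congr (_ + _); apply: eq_bigl => k.
  case: (eqVneq k j) => [->|kj]; first by rewrite andbF xy.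
  by rewrite andbT flip_other // eq_sym.
have -> : \sum_(j | x j != y j) lower v (enum_rank (flip j y)) 0 =
    \sum_(j | x j != y j) (\sum_(k | (x k == y k)) g j k + v (enum_rank y) 0).
  apply: eq_bigr => j xy; rewrite lowerE (bigD1 j) /=; last first.
    by rewrite flip_same; move: xy; case: (x j); case: (y j).
  rewrite flipK addrC; congr (_ + _); apply: eq_bigl => k.
  case: (eqVneq k j) => [->|kj]; first by rewrite andbF (negPf xy).
  by rewrite andbT flip_other // eq_sym.
rewrite !big_split /= !sumr_const.
have -> : \sum_(j | x j == y j) \sum_(k | x k != y k) g j k =
    \sum_(j | x j != y j) \sum_(k | x k == y k) g j k.
  rewrite exchange_big /=; apply: eq_bigr => j _; apply: eq_bigr => k _.
  by rewrite /g flipC.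
rewrite -addrA; congr (_ + _).
(* The terms that return to y are counted by D - i agreeing against i differing coordinates. Off
   level i they vanish. *)
have [hy|/hv->] := eqVneq (hamming x y) i; last by rewrite !mul0rn mulr0 addr0.
have c1 : #|[pred j | x j != y j]| = i by rewrite -hy /hamming cardsE.
have c2 : (#|[pred j | x j == y j]| + i)%N = D.
  rewrite -c1 -[RHS](card_ord D) -(cardC [pred j | x j == y j]);
    congr (_ + _)%N.
have DE : D%:R = #|[pred j | x j == y j]|%:R + i%:R :> C by rewrite -natrD c2.
transitivity (v (enum_rank y) 0 *+ #|[pred j | x j == y j]|); first by [].
by rewrite c1 DE -[v _ _ *+ i]mulr_natl -[LHS]mulr_natl; ring.
Qed.

Definition lowest r v := [/\ v != 0, on_level r v & lower v = 0].

(** Commuting past [raise] on level r + i contributes D - 2(r + i), and these sum over i < k to the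
    coefficient. *)
Lemma lower_iter_raise r v : lowest r v -> forall k,
  lower (iter k raise v) =
  (k%:R * (D%:R - 2 * r%:R + 1 - k%:R)) *: iter k.-1 raise v.
Proof.
case=> _ hv v0; have lv k : on_level (r + k)%N (iter k raise v).
  by elim: k => [|k IHk]; rewrite ?addn0 ?addnS; [|apply: raise_level].
elim=> [|k IHk]; first by rewrite /= v0 mul0r scale0r.
rewrite [in LHS]iterS (lower_raise (lv k)) IHk raiseZ.
case: k {IHk} => [|k] /=.
  by rewrite mul0r scale0r add0r addn0 mul1r addrK.
by rewrite -scalerDl; congr (_ *: _); rewrite natrD -!natr1; ring.
Qed.

(** Repeated lowering stops at level 0 at the latest. [P] will be membership in the module. *)
Lemma exists_lowest (P : V -> Prop) n v :
    (forall i u, P u -> on_level i u -> P (lower u)) ->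
    P v -> v != 0 -> on_level n v ->
  exists r u, P u /\ lowest r u.
Proof.
move=> hP; elim: n v => [|n IHn] v Pv v0 lv.
  by exists 0%N, v; split=> //; split=> //; apply: lower_level0.
have [l0|l0] := eqVneq (lower v) 0; first by exists n.+1, v.
exact: IHn (hP _ _ Pv lv) l0 (lower_level lv).
Qed.

(** Take d minimal with raise^(d+1) v = 0. Lowering this zero vector gives (d + 1) (D - 2r - d)
    times the nonzero raise^d v, so D = 2r + d. *)
Lemma lowest_length r v : lowest r v ->
  exists d, [/\ D = (2 * r + d)%N, iter d.+1 raise v = 0 &
    forall k, (k <= d)%N -> iter k raise v != 0].
Proof.
move=> hr; case: (hr) => v0 hv lv0.
have lv k : on_level (r + k)%N (iter k raise v).
  by elim: k => [|k IHk]; rewrite ?addn0 ?addnS; [|apply: raise_level].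
have ex : exists k, iter k.+1 raise v == 0.
  by exists D; apply/eqP/(on_level_gt (lv _)); rewrite addnS ltnS leq_addl.
case: (ex_minnP ex) => d /eqP d0 dmin; exists d.
have nz k : (k <= d)%N -> iter k raise v != 0.
  case: k => [|k] // kd; apply: contraL kd => /dmin.
  by rewrite -leqNgt.
split=> //.
have /esym/eqP := lower_iter_raise hr d.+1.
rewrite d0 lower0 scaler_eq0 (negPf (nz d _)) // orbF mulf_eq0 pnatr_eq0 /=.
have -> : D%:R - 2 * r%:R + 1 - d.+1%:R = D%:R - (2 * r + d)%:R :> C.
  by rewrite natrD natrM -natr1; ring.
by rewrite subr_eq0 eqr_nat => /eqP.
Qed.

Lemma dual_adjB_mul v y :
  (dual_adjB C x *m v) (enum_rank y) 0 =
  (-1) ^+ hamming x y * (D%:R - 2 * (hamming x y)%:R) * v (enum_rank y) 0.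
Proof. by rewrite diag_of_cube_mul idemF1E. Qed.

Lemma dual_adjB_level i v : on_level i v ->
  dual_adjB C x *m v = ((-1) ^+ i * (D%:R - 2 * i%:R)) *: v.
Proof.
move=> hv; apply: cV_ext => y; rewrite dual_adjB_mul [RHS]mxE.
by have [->//|/hv->] := eqVneq (hamming x y) i; rewrite !mulr0.
Qed.

Lemma dual_idem_level (i : 'I_D.+1) m v : on_level m v ->
  dual_idem C x i *m v = (m == i)%:R *: v.
Proof.
move=> hv; apply: cV_ext => y; rewrite diag_of_cube_mul [RHS]mxE.
have [->|/hv->] := eqVneq (hamming x y) m; last by rewrite !mulr0.
by case: (m == i).
Qed.

Lemma dual_idem_on_level (i : 'I_D.+1) v : on_level i (dual_idem C x i *m v).
Proof. by move=> y hy; rewrite diag_of_cube_mul (negPf hy) mul0r. Qed.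

Section Module.
Variable W : {vspace V}.
Hypothesis hW : T_invariant x W.

(** On a single level, raising is [adjA] followed by the dual idempotent of the next level, an
    element of T. *)
Lemma raise_stable i v : v \in W -> on_level i v -> raise v \in W.
Proof.
move=> vW hv; have lr := raise_level hv.
have [iD|iD] := leqP i.+1 D; last by rewrite (on_level_gt lr) ?mem0v.
have -> : raise v =
  dual_idem C x (Ordinal (iD : i.+1 < D.+1)%N) *m (adjA C D *m v).
  rewrite adjA_raise_lower mulmxDr (dual_idem_level _ lr) eqxx scale1r.
  rewrite (dual_idem_level _ (lower_level hv)) /= (_ : (i.-1 == i.+1) = false).
    by rewrite scale0r addr0.
  by apply/eqP; lia.
by apply: (hW (terwilliger_E C x _)); apply: (hW (terwilliger_A C x)).
Qed.

Lemma lower_stable i v : v \in W -> on_level i v -> lower v \in W.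
Proof.
move=> vW hv; rewrite -[lower v](addKr (raise v)) -adjA_raise_lower.
by rewrite memvD ?memvN ?(raise_stable vW hv) // (hW (terwilliger_A C x)).
Qed.

Lemma exists_lowest_in : W != 0%VS -> exists r v, v \in W /\ lowest r v.
Proof.
move=> W0.
have [y yE] : exists y, vpick W (enum_rank y) 0 != 0.
  apply/existsP; apply: contraNT W0; rewrite negb_exists -vpick0 => /forallP h.
  by apply/eqP/cV_ext => y; have := h y; rewrite negbK mxE => /eqP.
have hy : (hamming x y < D.+1)%N by rewrite ltnS hamming_le.
(* Projecting onto the level of a nonzero entry keeps that entry. *)
pose i := Ordinal hy.
apply: (@exists_lowest (fun v => v \in W) i (dual_idem C x i *m vpick W)).
- by move=> k u; apply: lower_stable.
- by apply: (hW (terwilliger_E C x i)); apply: memv_pick.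
- apply: contra_neq yE => /colP/(_ (enum_rank y)).
  by rewrite diag_of_cube_mul eqxx mul1r mxE.
- exact: dual_idem_on_level.
Qed.

End Module.

Lemma action_onE (W : {vspace V}) M v : v \in W ->
  action_on W M (vsproj W v) = vsproj W (M *m v).
Proof. by move=> vW; rewrite lfunE /= vsprojK. Qed.

(** The span of the raised lowest vectors is nonzero and T-invariant, so it is all of [W]. Distinct
    eigenvalues of [dual_adjB] make these vectors free, which gives the dimension. *)
Lemma irred_T_module_chain (W : {vspace V}) : irred_T_module x W -> ~~ odd D ->
  exists d e, [/\ ~~ odd d, e * e = 1, \dim {: subvs_of W} = d.+1 &
    in_chain d e (action_on W (dual_adjB C x)) (action_on W (adjA C D))
      (action_on W (mxC C x))].
Proof.
case=> W0 hW Wirr DN.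
have [r [v [vW hv]]] := exists_lowest_in hW W0.
have [d [DE ud unz]] := lowest_length hv.
pose u k := iter k raise v.
have lu k : on_level (r + k)%N (u k).
  by elim: k => [|k IHk]; rewrite ?addn0 ?addnS; [case: hv|apply: raise_level].
have uW k : u k \in W.
  by elim: k => [|k IHk] //=; apply: (raise_stable hW IHk (lu k)).
have dN : ~~ odd d by move: DN; rewrite DE oddD oddM.
pose e : C := (-1) ^+ r.
have e2 : e * e = 1 by rewrite -expr2 sqrr_sign.
have DR : D%:R = 2 * r%:R + d%:R :> C by rewrite {1}DE natrD natrM.
have lowu k : lower (u k) = chain_coef C d k *: u k.-1.
  rewrite (lower_iter_raise hv) /chain_coef; congr (_ *: _).
  by rewrite DR; ring.
have Au k : adjA C D *m u k = u k.+1 + chain_coef C d k *: u k.-1.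
  by rewrite adjA_raise_lower lowu.
have Bu k : dual_adjB C x *m u k = chain_eigval d e k *: u k.
  rewrite (dual_adjB_level (lu k)) /chain_eigval exprD; congr (_ *: _).
  by rewrite DR natrD /e; ring.
(* The averages of the eigenvalue at k with those at k + 1 and k - 1 are e (-1)^k and its
   negative. *)
have Cu k : mxC C x *m u k =
    (e * (-1) ^+ k) *: (u k.+1 - chain_coef C d k *: u k.-1).
  rewrite /mxC -scalemxAl mulmxDl -!mulmxA Au Bu mulmxDr -!scalemxAr Au !Bu.
  apply: scalar_ext => f; rewrite !(linearD, linearZ, linearN) /=.
  case: k => [|k] /=; rewrite ?chain_coef0 /chain_eigval !exprS -?natr1.
    by field.
  by rewrite -?natr1; field.
exists d, e.
pose s := [tuple u k | k < d.+1].
have uE k : (d < k)%N -> u k = 0.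
  move=> dk; rewrite /u -(subnK dk) iterD ud; elim: (k - d.+1)%N => //= m ->.
  exact: raise0.
have us k : u k \in <<s>>%VS.
  have [kd|/uE ->] := leqP k d; last exact: mem0v.
  apply/memv_span/tnthP; exists (Ordinal (kd : (k < d.+1)%N)).
  by rewrite tnth_mktuple.
have stable M : (forall k, M *m u k \in <<s>>%VS) ->
    forall z, z \in <<s>>%VS -> M *m z \in <<s>>%VS.
  move=> h z /(memv_img (linfun (mulmx M))); rewrite limg_span lfunE.
  apply/subvP/span_subvP => _ /mapP[_ /tnthP[k ->] ->].
  by rewrite lfunE tnth_mktuple; apply: h.
have sW : <<s>>%VS = W.
  have [|||] := Wirr <<s>>%VS.
  - by apply/span_subvP => _ /tnthP[k ->]; rewrite tnth_mktuple.
  (* Invariance is checked on the generators and propagates through the algebra operations. *)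
  - move=> M; elim=> {M} [|i||a M _ IHM|M N _ IHM _ IHN|M N _ IHM _ IHN] z zs.
    + by apply: stable zs => k; rewrite Au memvD ?memvZ.
    + by apply: stable zs => k; rewrite (dual_idem_level i (lu k)) memvZ.
    + by rewrite mul1mx.
    + by rewrite -scalemxAl memvZ ?IHM.
    + by rewrite mulmxDl memvD ?IHM ?IHN.
    + by rewrite -mulmxA IHM ?IHN.
  - by move=> s0; have := us 0%N; rewrite s0 memv0 (negPf (unz 0%N isT)).
  - by [].
have sfree : free s.
  apply/freeP => a a0 i; have e0 : e != 0 by rewrite signr_eq0.
  rewrite -(inord_val i).
  apply: (@eigenvectors_free _ _ (linfun (mulmx (dual_adjB C x))) u
    (chain_eigval d e) d.+1 _ _ (fun k => a (inord k))) => //.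
  - by move=> k kd; split; [apply: unz|rewrite lfunE /= Bu].
  - move=> k l /andP[kl ld]; apply: chain_eigval_inj => //.
    by rewrite kl ltnW.
  - rewrite -[RHS]a0; apply: eq_bigr => k _.
    by rewrite inord_val nth_mktuple.
split=> //.
  by rewrite dimvf [LHS](_ : _ = \dim W) // -sW (eqP sfree) size_tuple.
exists (fun k => vsproj W (u k)); split.
- apply: contra_neq (unz 0%N isT) => /(congr1 val) /=.
  by rewrite vsprojK ?uW // linear0.
- by move=> k; rewrite action_onE // Bu linearZ.
- by move=> k; rewrite action_onE // Au linearD linearZ.
- by move=> k; rewrite action_onE // Cu linearZ linearB linearZ.
Qed.

End RaisingLowering.

Theorem theorem13p9 (R : realType) (D : nat) (x : cube D)
    (W : {vspace cube_cV R[i] D}) :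
  (0 < D)%N -> ~~ odd D -> irred_T_module x W ->
  let A := action_on W (adjA R[i] D) in
  let B := action_on W (dual_adjB R[i] x) in
  let C := action_on W (mxC R[i] x) in
  [/\ leonard_triple A B C, totally_bipartite A B C & bannai_ito_type A B C].
Proof.
move=> _ DN hW A B C.
have [d [e [dN e2 dimW BAC]]] := irred_T_module_chain hW DN.
(* The two swaps generate all orders. Those with A, B and C in first place supply the three Leonard
   bases. *)
have ABC : in_chain d e A B C by case: BAC => w hw;
  apply: (in_chain_swap12 e2 hw).
have BCA := in_chain_swap23 e2 BAC.
have CBA : in_chain d e C B A by case: BCA => w hw;
  apply: (in_chain_swap12 e2 hw).
have CAB := in_chain_swap23 e2 CBA.
split.
- by split;
  [rewrite dimW|exact: in_chain_leonard_basis ABC|exact: in_chain_leonard_basis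
  BAC|exact: in_chain_leonard_basis CAB].
- by split;
  [exact: in_chain_zero_diagonals ABC|exact: in_chain_zero_diagonals BAC|exact:
  in_chain_zero_diagonals CAB].
- exact: in_chain_bannai_ito ABC.
Qed.
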